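(* Assume the Continuum Hypothesis. Then there is a Luzin mad family $\mathcal{A}$ which is quasi-normal; that is, $\mathcal{A}$ is a maximal almost disjoint family, $\mathcal{A}$ is Luzin, and the space $\Psi(\mathcal{A})$ is quasi-normal.
   Context: An almost disjoint family is an infinite family $\mathcal{A}$ of infinite subsets of $\omega$ such that $a\cap b$ is finite for all distinct $a,b\in\mathcal{A}$ (all almost disjoint families are assumed infinite). It is mad if it is maximal under inclusion among almost disjoint families, i.e. every infinite subset of $\omega$ has infinite intersection with some member of $\mathcal{A}$. It is Luzin if it can be enumerated (without repetitions) as $\{a_\alpha:\alpha<\omega_1\}$ so that for each $\alpha<\omega_1$ and each $n\in\omega$ the set $\{\beta<\alpha: a_\alpha\cap a_\beta\subseteq n\}$ is finite (where $n=\{0,\dots,n-1\}$). The Mrówka–Isbell space $\Psi(\mathcal{A})$ has underlying set $\omega\cup\mathcal{A}$ (disjoint union); each $\{n\}$ with $n\in\omega$ is open, and the basic open neighbourhoods of a point $a\in\mathcal{A}$ are the sets $\{a\}\cup(a\setminus F)$ with $F\subset\omega$ finite. In a topological space $X$, a set $A$ is regular closed if $A=\overline{\operatorname{int}(A)}$, and $\pi$-closed if it is the intersection of finitely many regular closed sets. Two sets $A,B\subseteq X$ are separated if there are disjoint open sets $U\supseteq A$ and $V\supseteq B$. A regular space is quasi-normal if any two disjoint $\pi$-closed sets are separated. An almost disjoint family $\mathcal{A}$ is called quasi-normal if $\Psi(\mathcal{A})$ is. *)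

(* Defs.v *)
From HB Require Import structures.
From mathcomp Require Import all_boot all_order.
From mathcomp Require Import boolp classical_sets functions cardinality wochoice.
From mathcomp Require Import filter topology.

Set Implicit Arguments.
Unset Strict Implicit.
Unset Printing Implicit Defensive.

Local Open Scope classical_set_scope.

Definition continuum_hypothesis : Prop :=
  forall X : set (set nat), countable X \/ (X #= [set: set nat])%card.

Definition almost_disjoint_family (A : set (set nat)) : Prop :=
  [/\ infinite_set A,
      (forall a, A a -> infinite_set a) &
      (forall a b, A a -> A b -> a <> b -> finite_set (a `&` b))].

Definition mad (A : set (set nat)) : Prop :=
  almost_disjoint_family A /\
  forall B, almost_disjoint_family B -> A `<=` B -> A = B.

(* [R] is a reflexive well-order of [W] of type omega_1: an uncountable
   well-order all of whose proper initial segments are countable. *)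
Definition omega1_order (W : eqType) (R : rel W) : Prop :=
  [/\ well_order R,
      (forall x, countable [set y | R y x]) &
      ~ countable [set: W]].

(* The order type omega_1 is unique up to isomorphism, so that it does not
   matter which copy [(W, R)] of it indexes the enumeration. *)
Definition luzin (A : set (set nat)) : Prop :=
  exists (W : eqType) (R : rel W) (a : W -> set nat),
    [/\ omega1_order R,
        injective a,
        range a = A &
        forall (x : W) (n : nat),
          finite_set [set y | [/\ R y x, y <> x & a x `&` a y `<=` `I_n]]].

Section TopologicalNotions.
Variable X : topologicalType.
Implicit Types S T : set X.

Definition pi_closed S : Prop :=
  exists C : set (set X),
    [/\ finite_set C,
        (forall D, C D -> regclosed D) &
        S = \bigcap_(D in C) D].

(* Separation by disjoint open sets; [separated] in the library means instead
   that neither set meets the closure of the other. *)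
Definition open_separated S T : Prop :=
  exists U V : set X,
    [/\ open U, open V, S `<=` U, T `<=` V & U `&` V = set0].

End TopologicalNotions.

Definition quasi_normal_space (X : topologicalType) : Prop :=
  regular_space X /\
  forall S T : set X, pi_closed S -> pi_closed T -> S `&` T = set0 ->
    open_separated S T.

(* The Mrowka-Isbell space: [inl n] is the point n, [inr a] the point a. *)
Definition Psi (A : set (set nat)) : Type := (nat + A)%type.

HB.instance Definition _ (A : set (set nat)) :=
  Choice.copy (Psi A) (nat + A)%type.

Section PsiTopology.
Variable A : set (set nat).

Definition Psi_basic (x : Psi A) (F : set nat) : set (Psi A) :=
  match x with
  | inl n => [set inl n]
  | inr a => [set inr a] `|` inl @` (set_val a `\` F)
  end.

Definition Psi_open (U : set (Psi A)) : Prop :=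
  forall x, U x -> exists2 F, finite_set F & Psi_basic x F `<=` U.

Lemma Psi_basicS x F G : F `<=` G -> Psi_basic x G `<=` Psi_basic x F.
Proof.
case: x => [n|a] FG z; first by [].
move=> [->|[m [am Gm] <-]]; [by left|right].
by exists m => //; split=> // /FG.
Qed.

Lemma Psi_openT : Psi_open setT.
Proof. by move=> x _; exists set0. Qed.

Lemma Psi_openI : setI_closed Psi_open.
Proof.
move=> U V oU oV x [/oU[F finF FU] /oV[G finG GV]].
exists (F `|` G); first by rewrite finite_setU.
by move=> z zFG; split; [apply: FU|apply: GV]; apply: Psi_basicS zFG => m;
  [left|right].
Qed.

Lemma Psi_open_bigU (I : Type) (f : I -> set (Psi A)) :
  (forall i, Psi_open (f i)) -> Psi_open (\bigcup_i f i).
Proof.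
move=> of_ x [i _ /of_[F finF Ff]]; exists F => // z /Ff fz.
by exists i.
Qed.

HB.instance Definition _ :=
  isOpenTopological.Build (Psi A) Psi_openT Psi_openI Psi_open_bigU.

Lemma Psi_openE : (@open (Psi A)) = Psi_open.
Proof. by []. Qed.

End PsiTopology.

Definition quasi_normal_family (A : set (set nat)) : Prop :=
  quasi_normal_space (Psi A).

(* Main.v *)
Require Import Defs.
From mathcomp Require Import all_boot all_order.
From mathcomp Require Import boolp classical_sets functions cardinality.
From mathcomp Require Import wochoice filter topology.

Set Implicit Arguments.
Unset Strict Implicit.
Unset Printing Implicit Defensive.

Local Open Scope classical_set_scope.

(* Well-order the subsets of nat in type omega_1 and let [a x] be chosen by
   recursion, almost disjoint from the earlier sets and satisfying the Luzin
   condition, so that it has infinite intersection with each of the countably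
   many sets [Y] preceding [x] that are not covered, up to a finite set, by
   finitely many earlier members. The resulting family A has the property that
   for any finitely many sets positive for the ideal generated by A some member
   of A meets all of them in infinite sets; with a single set this is
   maximality. For quasi-normality, a pi-closed set of Psi(A) is given by finitely
   many subsets of nat: its points in A are the members with infinite
   intersection with all of them. If two pi-closed sets are disjoint, the sets
   describing both cannot all be positive, so one of the pi-closed sets contains
   only finitely many points of A, and a closed set of that kind is separated
   from any closed set disjoint from it. *)

(** * Infinite and countable sets *)

Lemma infinite_natP (A : set nat) :
  infinite_set A <-> forall n, exists2 m, n <= m & A m.
Proof.
split=> [infA n|cofA /finite_seqP[s As]].
  have /infinite_setN0[m [Am /negP]] := infinite_setD infA (finite_II n).
  by rewrite -leqNgt; exists m.
have [m lt_m] := cofA (\max_(i <- s) i).+1.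
by rewrite As /= => /(@leq_bigmax_seq _ _ xpredT (fun i => i))/(_ isT);
  rewrite leqNgt lt_m.
Qed.

Lemma finite_inj (T U : Type) (f : T -> U) (A : set T) :
  {in A &, injective f} -> finite_set (f @` A) -> finite_set A.
Proof. by move=> f_inj; rewrite (eq_finite_set (inj_card_eq f_inj)). Qed.

Lemma countableU (T : Type) (A B : set T) :
  countable A -> countable B -> countable (A `|` B).
Proof.
move=> cA cB; have -> : A `|` B = \bigcup_(b in setT) (if b then A else B).
  apply/seteqP; split=> [x [Ax|Bx]|x [[] _ ?]].
  - by exists true.
  - by exists false.
  - by left.
  - by right.
by apply: bigcup_countable => // -[].
Qed.

Lemma uncountable_set_nat : ~ countable [set: set nat].
Proof.
move=> /countable_injP[f f_inj].
pose D := [set n | exists2 X : set nat, f X = n & ~ X n].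
have [DfD|nDfD] := pselect (D (f D)); last by apply: (nDfD); exists D.
have [X fXD nX] := DfD; apply: nX.
by have -> : X = D by apply: f_inj; rewrite ?inE.
Qed.

(** * Well-orders, the type omega_1 and recursion *)

Lemma well_order_antisym (T : eqType) (R : rel T) :
  well_order R -> antisymmetric R.
Proof.
move=> woR x y; apply: (@wo_chain_antisymmetric _ R predT) => //.
exact: (withinW woR).
Qed.

Lemma well_order_total (T : eqType) (R : rel T) : well_order R -> total R.
Proof. move=> woR x y; apply: (@wo_chainW _ R predT) => //.
exact: (withinW woR). Qed.

Definition strict (T : Type) (R : rel T) (y x : T) : Prop := R y x /\ y <> x.

Lemma well_order_strict_total (T : eqType) (R : rel T) x y :
  well_order R -> x <> y -> strict R x y \/ strict R y x.
Proof.
by move=> woR nxy; case/orP: (well_order_total woR x y) => Rxy;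
  [left|right]; split=> // /esym.
Qed.

Lemma well_order_wf (T : eqType) (R : rel T) :
  well_order R -> well_founded (strict R).
Proof.
move=> woR x; apply: contrapT => nAx.
have [|m [[/asboolP nAm m_min] _]] := woR [pred y | `[<~ Acc (strict R) y>]].
  by exists x; apply/asboolP.
apply: nAm; constructor=> y [Rym nym]; apply: contrapT => nAy.
apply: nym; apply: (well_order_antisym woR); rewrite Rym m_min //.
exact/asboolP.
Qed.

(** The least of [x], [y], [z] decides: if it is [y] or [z], antisymmetry makes two of the points
    equal. *)
Lemma well_order_trans (T : eqType) (R : rel T) :
  well_order R -> transitive R.
Proof.
move=> woR y x z Rxy Ryz.
have [|m [[+ m_min] _]] := woR (mem [:: x; y; z]).
  by exists x; rewrite inE eqxx.
have Rx := m_min x; have Ry := m_min y; have Rz := m_min z.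
move: Rx Ry Rz; rewrite !inE !eqxx !orbT => /(_ isT) Rx /(_ isT) Ry /(_ isT) Rz.
case/or3P=> /eqP em; subst m => //.
  by rewrite (well_order_antisym woR (x := x) (y := y)) // Rxy.
by rewrite (well_order_antisym woR (x := z) (y := y)) // Ry Ryz.
Qed.

(** If a well-order of [set nat] has an uncountable initial segment, take the least [x] where this
    happens. The part strictly below [x] is still uncountable, so CH gives a bijection [f] from
    [set nat] onto it, along which the order is pulled back. *)
Lemma CH_omega1_order : continuum_hypothesis ->
  exists R : rel (set nat), omega1_order R.
Proof.
move=> CH; have [R woR] := well_ordering_principle (set nat).
have [cR|/existsNP[x0 ncx0]] := pselect (forall x, countable [set y | R y x]).
  by exists R; split=> //; exact: uncountable_set_nat.
have [|x [[/asboolP ncx x_min] _]] :=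
    woR [pred x | `[<~ countable [set y | R y x]>]].
  by exists x0; apply/asboolP.
pose X := [set y | strict R y x].
have segX y : X y -> countable [set z | R z y].
  move=> [Ryx nyx]; apply: contrapT => ncy; apply: nyx.
  apply: (well_order_antisym woR); rewrite Ryx x_min //.
  exact/asboolP.
have [cX|/card_esym/card_set_bijP[f [fX f_inj _]]] := CH X.
  exfalso; apply: ncx; apply: (@sub_countable _ _ _ (X `|` [set x])).
    apply: subset_card_le => y /= Ryx.
    by have [->|nyx] := pselect (y = x); [right|left].
  by apply: countableU => //; exact: countable1.
have {}f_inj : injective f by move=> y z; apply: f_inj; rewrite inE.
exists (fun y z => R (f y) (f z)); split; last exact: uncountable_set_nat.
  apply: antisymmetric_well_order => [y z /(well_order_antisym woR)/f_inj //|A].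
  move=> [y Ay]; have [|m [[/asboolP[z Az <-] m_min] _]] :=
      woR [pred u | `[<exists2 z, z \in A & f z = u>]].
    by exists (f y); apply/asboolP; exists y.
  by exists z; split=> // u Au; apply: m_min; apply/asboolP; exists u.
move=> y; have /segX/countable_injP[g g_inj] := fX y I.
apply/countable_injP; exists (g \o f) => z u; rewrite !inE /= => Rz Ru.
by move=> /g_inj fzu; apply: f_inj; apply: fzu; rewrite inE.
Qed.

(** [get] falls back on a default value when no value fits, so the recursion is total and existence
    can be checked afterwards, by induction. *)
Lemma wf_choice (W : Type) (lt : W -> W -> Prop) (T : pointedType)
    (P : W -> set T -> T -> Prop) : well_founded lt ->
  exists a : W -> T, forall x,
    let C := a @` [set y | lt y x] in (exists b, P x C b) -> P x C (a x).
Proof.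
move=> wf_lt.
pose prev x (g : forall y, lt y x -> T) :=
  [set c | exists y (h : lt y x), g y h = c].
pose step x g := get (P x (@prev x g)).
exists (Fix wf_lt (fun=> T) step) => x C; rewrite Fix_eq; last first.
  move=> z f g fg; congr (step z _).
  apply: functional_extensionality_dep => y.
  by apply: functional_extensionality_dep => h.
set g := (fun y : W => fun=> _).
have -> : C = @prev x g.
  by apply/seteqP; split=> c;
    [move=> [y h <-]; exists y, h|move=> [y [h <-]]; exists y].
by move=> [b Pb]; exact: (getI Pb).
Qed.

(** * Positive sets and one step of the recursion *)

(* [Y] is positive for the ideal generated by [C] and the finite sets. *)
Definition positive (C : set (set nat)) (Y : set nat) : Prop :=
  forall F, F `<=` C -> finite_set F -> infinite_set (Y `\` \bigcup_(c in F) c).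

Lemma positiveS C D Y : C `<=` D -> positive D Y -> positive C Y.
Proof. by move=> CD Dpos F FC; apply: Dpos; exact: subset_trans FC CD. Qed.

Lemma almost_disjoint_positive (C : set (set nat)) b : infinite_set b ->
  (forall c, C c -> finite_set (c `&` b)) -> positive C b.
Proof.
move=> inf_b bC F FC finF.
have finbF : finite_set (\bigcup_(c in F) (c `&` b)).
  by apply: bigcup_finite => // c /FC; exact: bC.
apply: sub_infinite_set (infinite_setD inf_b finbF) => n [bn nFn].
by split=> // -[c Fc cn]; apply: nFn; exists c.
Qed.

(* One step of the recursion. Fix injections [f] of [C] and [g] of [S] into
   nat. Every point put into [b] comes with a stage [k], is at least [k], and
   avoids all [c] in [C] with [f c < k]: the point [p c] of [c] has stage
   [f c], and the point [q k Y] of [Y] has stage [k >= g Y]. *)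
Lemma diagonal_step (C S : set (set nat)) :
    countable C -> countable S -> almost_disjoint_family C ->
  exists b : set nat,
    [/\ infinite_set b,
        (forall c, C c -> finite_set (b `&` c)),
        (forall n, finite_set [set c | C c /\ b `&` c `<=` `I_n]) &
        (forall Y, S Y -> positive C Y -> infinite_set (b `&` Y))].
Proof.
move=> /countable_injP[f f_inj] /countable_injP[g g_inj] [infC C_inf C_ad].
pose below (T : Type) (B : set T) (h : T -> nat) k := [set c | B c /\ h c < k].
have below_fin (T : Type) (B : set T) h k : {in B &, injective h} ->
    finite_set (below T B h k).
  move=> h_inj; apply: (@finite_inj _ _ h).
    by move=> c d; rewrite !inE => -[Bc _] [Bd _]; apply: h_inj; rewrite inE.
  by apply: sub_finite_set (finite_II k) => _ [c [_ lt_ck] <-].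
pose avoid k := \bigcup_(c in below _ C f k) c.
have pick (Y : set nat) k : infinite_set (Y `\` avoid k) ->
    exists m, [/\ k <= m, Y m & ~ avoid k m].
  by move=> /infinite_natP/(_ k)[m le_km [Ym nm]]; exists m.
have /choice[p pP] c : exists m, C c -> [/\ f c <= m, c m & ~ avoid (f c) m].
  have [Cc|nCc] := pselect (C c); last by exists 0.
  have [|m mP] := pick c (f c); last by exists m.
  suff: positive (below _ C f (f c)) c by apply => //; exact: below_fin.
  apply: almost_disjoint_positive; first exact: C_inf.
  move=> d [Cd lt_dc]; apply: C_ad => // dc.
  by move: lt_dc; rewrite dc ltnn.
have /choice[q qP] (u : nat * set nat) : exists m, positive C u.2 ->
    [/\ u.1 <= m, u.2 m & ~ avoid u.1 m].
  case: u => k Y /=.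
  have [Ypos|nYpos] := pselect (positive C Y); last by exists 0.
  have [|m mP] := pick Y k; last by exists m.
  by apply: Ypos; [move=> c []|exact: below_fin].
pose b := p @` C `|`
  [set q u | u in [set u | [/\ S u.2, positive C u.2 & g u.2 <= u.1]]].
have below_unbounded n : exists2 c, C c & n <= f c.
  apply: contrapT => nC; apply: infC.
  apply: sub_finite_set (below_fin _ C f n f_inj) => c Cc; split=> //.
  by rewrite ltnNge; apply/negP => le_nc; apply: nC; exists c.
exists b; split.
- apply/infinite_natP => n; have [c Cc le_nc] := below_unbounded n.
  by exists (p c); [have [/(leq_trans le_nc)] := pP c Cc|left; exists c].
- move=> c Cc.
  (* A point of [b] in [c] cannot have a stage above [f c]. Only finitely many points of [b] have
     such a stage, since [g Y] is at most the stage of [q (k, Y)]. *)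
  pose E := p @` below _ C f (f c).+1 `|`
    q @` (`I_(f c).+1 `*` below _ S g (f c).+1).
  apply: (@sub_finite_set _ _ E); last first.
    rewrite /E finite_setU; split; apply: finite_image; first exact: below_fin.
    by apply: finite_setX; [exact: finite_II|exact: below_fin].
  have stage k m : c m -> ~ avoid k m -> k < (f c).+1.
    move=> cm nm; rewrite ltnS leqNgt; apply/negP => lt_ck.
    by apply: nm; exists c.
  move=> _ [[[d Cd <-]|[[k Y] /= [SY Ypos le_Yk] <-]]] cm.
    left; exists d => //; split=> //.
    by have [_ _ ?] := pP d Cd; exact: stage cm _.
  right; exists (k, Y) => //; have [_ _ /= nm] := qP (k, Y) Ypos.
  by have lt_k := stage _ _ cm nm; do 2![split=> //]; exact: leq_ltn_trans lt_k.
- move=> n; apply: sub_finite_set (below_fin _ C f n f_inj) => c [Cc bc].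
  split=> //; have [le_c pc _] := pP c Cc.
  by apply: (leq_ltn_trans le_c); apply: (bc (p c)); split=> //; left; exists c.
- move=> Y SY Ypos; apply/infinite_natP => n.
  (* Stage at least [g Y] puts the point into [b]; stage at least [n] makes it large. *)
  have [le_m Ym _] := qP (maxn n (g Y), Y) Ypos.
  exists (q (maxn n (g Y), Y)); first by apply: leq_trans le_m; exact: leq_maxl.
  split=> //; right; exists (maxn n (g Y), Y) => //.
  by split=> //; exact: leq_maxr.
Qed.

(** * The sequence of type omega_1 *)

(* The first omega members of the family are taken from the columns of a copy
   of nat * nat, which avoids that finitely many members cover nat. *)
Definition column (n : nat) : set nat := range (fun k : nat => pickle (n, k)).

Lemma infinite_column n : infinite_set (column n).
Proof.
move=> /finite_inj fin_col; apply: infinite_nat; apply: fin_col.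
by move=> k l _ _ /(pcan_inj pickleK)[].
Qed.

Lemma columnI m n : column m `&` column n !=set0 -> m = n.
Proof. by move=> [_ [[k _ <-] [l _ /(pcan_inj pickleK)[]]]]. Qed.

Lemma infinite_range_column : infinite_set (range column).
Proof.
move=> /finite_inj fin_col; apply: infinite_nat; apply: fin_col.
move=> m n _ _ eq_mn; apply: columnI; rewrite eq_mn setIid.
exact/infinite_setN0/infinite_column.
Qed.

Lemma countable_range (f : nat -> set nat) : countable (range f).
Proof. exact: sub_countable (card_image_le _ _) (countableP _). Qed.

(** The indices are themselves subsets of nat, so [R] also schedules the sets [Y] to be met. While
    there are finitely many earlier values a new column is taken; afterwards [diagonal_step]
    applies. *)
Lemma luzin_sequence (R : rel (set nat)) : omega1_order R ->
  exists a : set nat -> set nat,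
    [/\ (forall x, infinite_set (a x)),
        (forall x y, strict R y x -> a y <> a x /\ finite_set (a x `&` a y)),
        (forall x n,
          finite_set [set y | strict R y x /\ a x `&` a y `<=` `I_n]) &
        (forall G, finite_set G -> (forall Y, G Y -> positive (range a) Y) ->
          exists x, forall Y, G Y -> infinite_set (a x `&` Y))].
Proof.
move=> [woR cR ncR]; pose good x C b :=
  (finite_set C -> range column b /\ ~ C b) /\
  (infinite_set C -> [/\ infinite_set b,
    (forall c, C c -> finite_set (b `&` c)),
    (forall n, finite_set [set c | C c /\ b `&` c `<=` `I_n]) &
    (forall Y, strict R Y x -> positive C Y -> infinite_set (b `&` Y))]).
have [a a_good] := wf_choice good (well_order_wf woR).
pose C x := a @` [set y | strict R y x].
have cseg x : countable [set y | strict R y x].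
  apply: sub_countable (cR x); apply: subset_card_le => y.
  by case.
have CS x y : strict R y x -> C y `<=` C x.
  move=> [Ryx nyx] _ [z [Rzy nzy] <-]; exists z => //; split.
    exact: well_order_trans woR _ _ _ Rzy Ryx.
  move=> zx; apply: nyx; apply: (well_order_antisym woR).
  by rewrite Ryx -zx.
have aP x : [/\ good x (C x) (a x), infinite_set (a x) &
    forall y, strict R y x -> a y <> a x /\ finite_set (a x `&` a y)].
  elim/(well_founded_ind (well_order_wf woR)): x => x IH.
  have [finC|infC] := pselect (finite_set (C x)).
    have gx : good x (C x) (a x).
      apply: a_good => /=.
      have [b [colb nCb]] :=
        infinite_setN0 (infinite_setD infinite_range_column finC).
      by exists b; split.
    have [[m _ colm] nCx] := gx.1 finC.
    split=> //; first by rewrite -colm; exact: infinite_column.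
    (* [C y] is finite too, so [a y] is also a column. *)
    move=> y yx; have [gy _ _] := IH y yx.
    have [[n _ coln] _] := gy.1 (sub_finite_set (CS _ _ yx) finC).
    have nyx : a y <> a x by move=> eq_yx; apply: nCx; rewrite -eq_yx; exists y.
    split=> //; suff -> : a x `&` a y = set0 by [].
    rewrite -colm -coln; apply: contrapT => /eqP/set0P/columnI mn.
    by apply: nyx; rewrite -colm -coln mn.
  have CxAD : almost_disjoint_family (C x).
    split=> // [_ [y yx <-]|_ _ [y yx <-] [z zx <-] nyz].
      by have [] := IH y yx.
    have [|yz|zy] := @well_order_strict_total _ _ y z woR.
    - by move=> yz; apply: nyz; rewrite yz.
    - by have [_ _ /(_ y yz)[]] := IH z zx; rewrite setIC.
    - by have [_ _ /(_ z zy)[]] := IH y yx.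
  have gx : good x (C x) (a x).
    apply: a_good => /=.
    have [|b bP] := diagonal_step _ (cseg x) CxAD; last by exists b; split.
    exact: sub_countable (card_image_le _ _) (cseg x).
  have [ax_inf axC _ _] := gx.2 infC; split=> // y yx.
  have axy : finite_set (a x `&` a y) by apply: axC; exists y.
  by split=> // eq_yx; apply: ax_inf; rewrite -[a x]setIid -{2}eq_yx.
have a_inj : injective a.
  move=> x y eq_xy; apply: contrapT => /(well_order_strict_total woR)[xy|yx].
    by have [_ _ /(_ x xy)[]] := aP y.
  by have [_ _ /(_ y yx)[nyx _]] := aP x; apply: nyx.
exists a; split=> [x|x|x n|G finG Gpos]; try by have [] := aP x.
  have [[_ gx] _ _] := aP x; apply: (@finite_inj _ _ a).
    by move=> y z _ _; exact: a_inj.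
  have [finC|/gx[_ _ fin_n _]] := pselect (finite_set (C x)).
    by apply: sub_finite_set finC => _ [y [yx _] <-]; exists y.
  by apply: sub_finite_set (fin_n n) => _ [y [yx yn] <-]; split=> //; exists y.
(* An index outside this countable set comes after all of [G] and is treated by the diagonal step,
   so it meets every [Y] in [G]. *)
pose bad := \bigcup_(Y in G) [set x | R x Y] `|` [set x | finite_set (C x)].
have cbad : countable bad.
  apply: countableU.
    by apply: bigcup_countable => // ; exact: finite_set_countable.
  (* Indices with finitely many earlier values carry columns, and [a] is injective. *)
  have /countable_injP[h h_inj] := countable_range column.
  apply/countable_injP; exists (h \o a) => x y; rewrite !inE /= => finx finy.
  have [[+ _] _ _] := aP x => /(_ finx)[colx _].
  have [[+ _] _ _] := aP y => /(_ finy)[coly _].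
  by move=> /h_inj; rewrite !inE => /(_ colx coly); exact: a_inj.
have [x nbadx] : exists x, ~ bad x.
  apply/existsNP => badT; apply: ncR.
  by suff <- : bad = setT by []; apply/seteqP; split.
exists x => Y GY.
have infC : infinite_set (C x) by move=> finC; apply: nbadx; right.
have nRxY : ~ R x Y by move=> RxY; apply: nbadx; left; exists Y.
have [[_ /(_ infC)[_ _ _ meets]] _ _] := aP x; apply: meets.
  case/orP: (well_order_total woR x Y) => // RYx; split=> // Yx.
  by apply: nRxY; rewrite Yx in RYx *.
by apply: positiveS (Gpos Y GY) => _ [y _ <-]; exists y.
Qed.

(** * Closed sets of Psi(A) and their traces on nat *)

Lemma pi_closed_closed (X : topologicalType) (S : set X) :
  pi_closed S -> closed S.
Proof.
move=> [C [_ C_reg ->]]; apply: closed_bigI => D CD.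
by rewrite -(C_reg D CD); exact: closed_closure.
Qed.

Section PsiSpace.
Variable A : set (set nat).
Hypothesis A_ad : almost_disjoint_family A.
Implicit Types (a b : A) (S T : set (Psi A)).

Lemma open_inl (n : nat) : open [set (inl n : Psi A)].
Proof. by rewrite Psi_openE => _ ->; exists set0. Qed.

Lemma open_Psi_basic (x : Psi A) F : finite_set F -> open (Psi_basic x F).
Proof.
move=> finF; rewrite Psi_openE; case: x => [n|a] z.
  by move=> ->; exists set0.
case=> [->|[m [am nFm] <-]]; first by exists F.
by exists set0 => // _ ->; right; exists m.
Qed.

Lemma Psi_basic_self (x : Psi A) F : Psi_basic x F x.
Proof. by case: x => [n|a] //; left. Qed.

Lemma nbhs_PsiP (x : Psi A) U :
  nbhs x U <-> exists2 F, finite_set F & Psi_basic x F `<=` U.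
Proof.
rewrite nbhsE; split=> [[B [oB Bx] BU]|[F finF FU]].
  move: oB; rewrite Psi_openE => /(_ x Bx)[F finF FB].
  by exists F => //; exact: subset_trans FB BU.
exists (Psi_basic x F) => //; split; first exact: open_Psi_basic.
exact: Psi_basic_self.
Qed.

(** Each n is isolated, and a basic neighbourhood of a point of [A] contains no other point of [A];
    only accumulation of integers matters. *)
Lemma Psi_closedP S : closed S <->
  forall a, infinite_set (set_val a `&` [set n | S (inl n)]) -> S (inr a).
Proof.
split=> [cS a inf_aS|S_acc [n|a] clS].
- apply: cS => U /nbhs_PsiP[F finF FU].
  have [n [[an Sn] nFn]] := infinite_setN0 (infinite_setD inf_aS finF).
  by exists (inl n); split=> //; apply: FU; right; exists n.
- have [|z [Sz <-]] := clS [set (inl n : Psi A)]; last exact: Sz.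
  by apply/nbhs_PsiP; exists set0.
apply: contrapT => nSa; have /contrapT finaS := contra_not (S_acc a) nSa.
have [|z [Sz]] := clS (Psi_basic (inr a) (set_val a `&` [set n | S (inl n)])).
  by apply/nbhs_PsiP; exists (set_val a `&` [set n | S (inl n)]).
case=> [za|[m [am nSm] zm]]; first by apply: nSa; rewrite -za.
by apply: nSm; split=> //=; rewrite zm.
Qed.

Lemma closed_Psi_basic (x : Psi A) F : closed (Psi_basic x F).
Proof.
have [_ _ A_adj] := A_ad.
apply/Psi_closedP => a; case: x => [n|b] inf_a.
  exfalso; apply: inf_a; apply: sub_finite_set (finite_set1 n).
  by move=> m [_ []].
have [->|nab] := pselect (a = b); first by left.
exfalso; apply: inf_a.
apply: (@sub_finite_set _ _ (set_val a `&` set_val b)).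
  by move=> m [am [//|[k [bk _] [km]]]]; split=> //; rewrite -km.
by apply: A_adj; [exact: set_valP|exact: set_valP|move=> /val_inj].
Qed.

Lemma Psi_regular : regular_space (Psi A).
Proof.
move=> x U /nbhs_PsiP[F finF FU].
exists (Psi_basic x F); first by apply/nbhs_PsiP; exists F.
by rewrite -(closure_id _).1 //; exact: closed_Psi_basic.
Qed.

(** If [a] had finite trace on [D], the neighbourhood of [a] omitting that trace could meet the
    interior of [D] only in [a]. Then [a] would be interior to [D], so almost all of [a] would lie
    in [D]. *)
Lemma regclosed_inr (D : set (Psi A)) a : regclosed D ->
  D (inr a) <-> infinite_set (set_val a `&` [set n | D (inl n)]).
Proof.
have [_ A_inf _] := A_ad; move=> rD; split; last first.
  by apply: (Psi_closedP D).1; rewrite -rD; exact: closed_closure.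
rewrite -{1}rD => clDa finaD.
have [|z [Dz]] := clDa (Psi_basic (inr a) (set_val a `&` [set n | D (inl n)])).
  by apply/nbhs_PsiP; exists (set_val a `&` [set n | D (inl n)]).
case=> [za|[m [am nDm] zm]]; last first.
  by apply: nDm; split=> //=; rewrite zm; exact: interior_subset.
move: Dz; rewrite za => /nbhs_PsiP[F finF FD].
apply: (A_inf (set_val a)); first exact: set_valP.
apply: (@sub_finite_set _ _ (F `|` (set_val a `&` [set n | D (inl n)]))).
  move=> n an; have [Fn|nFn] := pselect (F n); first by left.
  by right; split=> //; apply: FD; right; exists n.
by rewrite finite_setU.
Qed.

(** [G] keeps one trace per regular closed set: a member may meet each trace in an infinite set and
    their intersection in a finite one. *)
Lemma pi_closed_trace S : pi_closed S -> exists G : set (set nat),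
  [/\ finite_set G, (forall n, S (inl n) <-> (forall Y, G Y -> Y n)) &
      forall a, S (inr a) <-> (forall Y, G Y -> infinite_set (set_val a `&` Y))].
Proof.
move=> [C [finC C_reg ->]]; pose trace D := [set n | D (inl n : Psi A)].
exists (trace @` C); split; first exact: finite_image.
  move=> n; split=> [SD _ [D CD <-]|GY D CD]; first exact: SD.
  by apply: (GY (trace D)); exists D.
move=> a; split=> [SD _ [D CD <-]|GY D CD].
  by apply/(regclosed_inr _ (C_reg D CD)); exact: SD.
by apply/(regclosed_inr _ (C_reg D CD)); apply: GY; exists D.
Qed.

Lemma finite_separated S T : closed S -> closed T -> S `&` T = set0 ->
  finite_set [set a | S (inr a)] -> open_separated S T.
Proof.
move=> cS cT ST0 finS.
have disjST x : S x -> ~ T x.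
  by move=> Sx Tx; have : set0 x by rewrite -ST0; split.
have /choice[F FP] a : exists F, S (inr a) ->
    finite_set F /\ Psi_basic (inr a) F `<=` ~` T.
  have [Sa|nSa] := pselect (S (inr a)); last by exists set0.
  have : open (~` T) by exact: closed_openC.
  by rewrite Psi_openE => /(_ (inr a) (disjST _ Sa))[F finF FT]; exists F.
(* Adding finitely many clopen basic sets to [S] keeps it closed and makes it open, so its
   complement can serve around [T]. *)
pose U := S `|` \bigcup_(a in [set a | S (inr a)]) Psi_basic (inr a) (F a).
exists U, (~` U); split.
- rewrite Psi_openE => -[n Un|a [Sa|[b Sb]]]; first by exists set0 => // _ ->.
    have [finF _] := FP a Sa; exists (F a) => // z az.
    by right; exists a.
  have [finF _] := FP b Sb; case=> [[->]|[? _ //]].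
  exists (F b) => // z bz.
  by right; exists b.
- apply: closed_openC; apply: closedU => //; apply: closed_bigcup => // a _.
  exact: closed_Psi_basic.
- by left.
- move=> x Tx [/disjST //|[a Sa ax]].
  by have [_ /(_ _ ax)] := FP a Sa.
- by rewrite setICr.
Qed.

(** A finite [F] covers [Y] up to a finite set, and a member outside [F] has finite intersection
    with each set of [F]. *)
Lemma nonpositive_finite (Y : set nat) : ~ positive A Y ->
  finite_set [set a : A | infinite_set (set_val a `&` Y)].
Proof.
move=> /existsNP[F /not_implyP[FA /not_implyP[finF /contrapT finY]]].
apply: (@finite_inj _ _ set_val); first by move=> a b _ _ /val_inj.
apply: (sub_finite_set _ finF) => _ [a inf_aY <-]; apply: contrapT => nFa.
have [_ _ A_adj] := A_ad.
apply: inf_aY; apply: (@sub_finite_set _ _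
  ((Y `\` \bigcup_(c in F) c) `|` \bigcup_(c in F) (set_val a `&` c))).
  move=> n [an Yn]; have [[c Fc cn]|nFn] := pselect ((\bigcup_(c in F) c) n).
    by right; exists c.
  by left.
rewrite finite_setU; split=> //; apply: bigcup_finite => // c Fc.
apply: A_adj; [exact: set_valP|exact: FA|].
by move=> ac; apply: nFa; rewrite ac.
Qed.

(** * Quasi-normality and maximality *)

Hypothesis A_meets : forall G : set (set nat), finite_set G ->
  (forall Y, G Y -> positive A Y) ->
  exists2 a, A a & forall Y, G Y -> infinite_set (a `&` Y).

Lemma meets_quasi_normal : quasi_normal_family A.
Proof.
split=> [|S T piS piT ST0]; first exact: Psi_regular.
have [cS cT] := (pi_closed_closed piS, pi_closed_closed piT).
have [G [finG _ SG]] := pi_closed_trace piS.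
have [H [finH _ TH]] := pi_closed_trace piT.
have [GHpos|] := pselect (forall Y, (G `|` H) Y -> positive A Y).
  (* This [a] would be a common point of [S] and [T]. *)
  have [|a /mem_set Aa aGH] := A_meets _ GHpos; first by rewrite finite_setU.
  have [] : set0 (inr (SigSub Aa) : Psi A).
  by rewrite -ST0; split; [apply/SG|apply/TH] => Y ?; apply: aGH; [left|right].
move=> /existsNP[Y /not_implyP[GHY /nonpositive_finite finY]].
case: GHY => [GY|HY].
  by apply: finite_separated => //; apply: sub_finite_set finY => a /SG/(_ Y GY).
have [||||U [V [oU oV TU SV UV0]]] := @finite_separated T S => //.
- by rewrite setIC.
- by apply: sub_finite_set finY => a /TH/(_ Y HY).
by exists V, U; split=> //; rewrite setIC.
Qed.

(** A new set [b] almost disjoint from all members would be positive, and [A_meets] for the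
    singleton of [b] contradicts this. *)
Lemma meets_mad : mad A.
Proof.
split=> // B [_ B_inf B_ad] AB; apply/seteqP; split=> // b Bb.
apply: contrapT => nAb.
have b_ad c : A c -> finite_set (c `&` b).
  by move=> Ac; apply: B_ad => //; [exact: AB|move=> cb; apply: nAb; rewrite -cb].
have [_ ->|a Aa ab] := A_meets (finite_set1 b).
  exact: almost_disjoint_positive (B_inf b Bb) b_ad.
exact: ab b erefl (b_ad a Aa).
Qed.

End PsiSpace.

Theorem mainTheorem3 (CH : continuum_hypothesis) :
  exists A : set (set nat), [/\ mad A, luzin A & quasi_normal_family A].
Proof.
have [R omegaR] := CH_omega1_order CH; have [woR _ _] := omegaR.
have [a [a_inf a_ad a_luzin a_meets]] := luzin_sequence omegaR.
have a_inj : injective a.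
  move=> x y eq_xy; apply: contrapT =>
    /(well_order_strict_total woR)[/a_ad|/a_ad] [nxy _]; exact: nxy.
have A_ad : almost_disjoint_family (range a).
  split=> [|_ [x _ <-] //|_ _ [x _ <-] [y _ <-] nxy].
    move=> /finite_inj finW; apply: uncountable_set_nat.
    by apply: finite_set_countable; apply: finW => x y _ _; exact: a_inj.
  have [|/a_ad[_]|/a_ad[_] //] := @well_order_strict_total _ _ x y woR;
    last by rewrite setIC.
  by move=> xy; apply: nxy; rewrite xy.
have A_meets (G : set (set nat)) : finite_set G ->
    (forall Y, G Y -> positive (range a) Y) ->
    exists2 b, range a b & forall Y, G Y -> infinite_set (b `&` Y).
  by move=> finG /(a_meets _ finG)[x meets]; exists (a x) => //; exists x.
exists (range a); split; [exact: meets_mad| |exact: meets_quasi_normal].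
exists (set nat : eqType), R, a; split=> // x n.
apply: sub_finite_set (a_luzin x n) => y [Ryx nyx xy].
by split.
Qed.
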